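(* Let $m,n,k$ be positive integers with $k\le n$, and let $Q$ be the probability measure on $(\mathbb{Z}/m\mathbb{Z})^n$ that is the law of $a_{i_1}e_{i_1}+a_{i_2}e_{i_2}+\dots+a_{i_k}e_{i_k}$, where $\{i_1,\dots,i_k\}\subset\{1,\dots,n\}$ is a uniformly random $k$-element subset and $a_{i_1},\dots,a_{i_k}\in\mathbb{Z}/m\mathbb{Z}$ are independent and uniform (so that each choice of subset and coefficients has weight $\frac{1}{\binom nk m^k}$). For the random walk on $(\mathbb{Z}/m\mathbb{Z})^n$ generated by $Q$, if $\ell=\frac{n+1}{2k}\log(mn)+\frac{c(n+1)}{2k}$, then for every $x\in(\mathbb{Z}/m\mathbb{Z})^n$, $$4\lVert Q_x^{*\ell}-U\rVert_{T.V.}^2\le e^{-c}.$$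
   Context: $e_1,\dots,e_n$ is the standard basis of $(\mathbb{Z}/m\mathbb{Z})^n$. The walk has transition matrix $Q(x,x+g)=Q(g)$; $Q_x^{*\ell}$ is the law after $\ell$ steps started from $x$, $U$ is the uniform measure on $(\mathbb{Z}/m\mathbb{Z})^n$, and $\lVert \mu-\nu\rVert_{T.V.}=\sup_A|\mu(A)-\nu(A)|$. $\log$ is the natural logarithm. Since $\ell$ is a number of steps, $c$ is a real number understood to be such that $\ell$ is a nonnegative integer. *)

(* Defs.v *)
From HB Require Import structures.
From mathcomp Require Import all_boot all_order all_fingroup all_algebra.
From mathcomp Require Import all_classical all_reals all_analysis.

Set Implicit Arguments.
Unset Strict Implicit.
Unset Printing Implicit Defensive.

Import Order.TTheory GRing.Theory Num.Theory.

Local Open Scope ring_scope.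

(* Z/mZ for every m > 0; unlike 'Z_m, this is the trivial group for m = 1. *)
Notation Zmod m := 'I_m.-1.+1.

Notation Zvec m n := 'rV[Zmod m]_n.

Definition basis_vec (m n : nat) (i : 'I_n) : Zvec m n :=
  \row_(j < n) (if j == i then inZp 1 else 0).

(* Measures on a finite type are given by their mass functions. *)
Section FiniteMeasures.
Variables (R : realType) (T : finType).

Definition meas (mu : T -> R) (A : {set T}) : R := \sum_(x in A) mu x.

Definition uniform_mass (_ : T) : R := #|T|%:R^-1.

Definition tv_dist (mu nu : T -> R) : R :=
  sup (range (fun A : {set T} => `|meas mu A - meas nu A|)).

End FiniteMeasures.

Section Walk.
Variables (R : realType) (G : finZmodType).

Definition trans (Q : G -> R) (x y : G) : R := Q (y - x).

Fixpoint walk_law (Q : G -> R) (x : G) (l : nat) : G -> R :=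
  match l with
  | 0 => fun y => (y == x)%:R
  | l'.+1 => fun y => \sum_(z : G) walk_law Q x l' z * trans Q z y
  end.

End Walk.

(* The coefficients are indexed by the chosen subset S only. As Z/mZ has no
   ring structure in the library when m = 1, the product a_i e_i is written as
   the a_i-fold multiple of e_i. *)
Definition comb_vec (m n : nat) (S : {set 'I_n})
    (a : {ffun {i : 'I_n | i \in S} -> Zmod m}) : Zvec m n :=
  \sum_(i : {i : 'I_n | i \in S}) basis_vec m (val i) *+ a i.

Definition ksubset_mass (R : realType) (m n k : nat) (g : Zvec m n) : R :=
  \sum_(S : {set 'I_n} | #|S| == k)
    \sum_(a : {ffun {i : 'I_n | i \in S} -> Zmod m} | comb_vec a == g)
      ('C(n, k)%:R * m%:R ^+ k)^-1.

(* Main.v *)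
Require Import Defs.
From HB Require Import structures.
From mathcomp Require Import all_boot all_order all_fingroup all_algebra.
From mathcomp Require Import all_classical all_reals all_analysis.
From mathcomp Require Import ring lra.
Import Order.TTheory GRing.Theory Num.Theory.
Local Open Scope ring_scope.

(**
  After l steps let A be the random set of coordinates that no step has
  chosen.  Given A, the walk agrees with its starting point x on A and is
  uniform and independent on the other coordinates; call this conditional law
  pinned A.  So the law of the walk is the mixture of the laws pinned A
  (lemma [walk_lawE]).

  For a fixed A the law pinned A can be far from uniform, but the distribution of
  A is invariant under permutations of the coordinates, so A may be replaced
  by a uniformly random set of the same size.  The heart of the proof is that
  the average nu_a of pinned A over the sets A of size a satisfies
      || nu_a - U || <= (a / 2) * sqrt (m / n)        ([symm_pinned_dist]).
  This bound is linear in a.  Averaging it over the law of A therefore involves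
  nothing about the dependence between coordinates, only the mean
  E #|A| = n (1 - k/n)^l, and gives
      4 || Q^l - U ||^2 <= m n (1 - k/n)^(2l) <= m n exp (- 2 l k / n),
  which is at most exp (-c) for l as in the theorem.

  To prove the linear bound, compare nu_(a+1) with nu_a.  Pinning one more
  coordinate, chosen at random among the r = n - a free ones, multiplies the
  density of pinned A by m/r times the number of free coordinates that agree
  with x.  Under pinned A this factor has mean 1 and variance (m - 1) / r, so
  the step costs at most (1/2) sqrt ((m - 1) / (n - a)) in total variation
  ([avg_pinnedU1_dist]).  This is at most (1/2) sqrt (m / n) as soon as
  m a <= n, and then the steps add up.  If on the contrary m a > n, then
  m (a + 1)^2 >= 4 m a > 4 n, so the bound claimed for nu_(a+1) exceeds 1 and
  holds trivially.
*)

(** * Expectations over the set of coordinates never chosen *)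

Section Erasure.
Set Implicit Arguments.
Unset Strict Implicit.
Variables (R : realType) (n k : nat).
Implicit Types (F G : {set 'I_n} -> R) (A S : {set 'I_n}).

(** One step removes a uniformly random k-subset S from the set of coordinates
    not yet chosen.  The operator acts on functions of that set, so that
    [iter l erase F setT] is the expectation of F after l steps, and no
    distribution on sets has to be handled. *)
Definition erase F A : R :=
  'C(n, k)%:R^-1 * \sum_(S : {set 'I_n} | #|S| == k) F (A :\: S).

Lemma eraseE F A :
  erase F A = 'C(n, k)%:R^-1 * \sum_(S : {set 'I_n} | #|S| == k) F (A :\: S).
Proof. by []. Qed.

Lemma iter_eraseS l F A :
  iter l.+1 erase F A = iter l erase (erase F) A.
Proof. by rewrite iterSr. Qed.

Lemma eq_iter_erase l F G : F =1 G -> iter l erase F =1 iter l erase G.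
Proof.
move=> eqFG; elim: l => //= l IHl A; congr (_ * _).
exact: eq_bigr.
Qed.

Lemma iter_erase_norm_le l F G A :
  (forall B, `|F B| <= G B) -> `|iter l erase F A| <= iter l erase G A.
Proof.
move=> leFG; elim: l A => //= l IHl A.
rewrite !eraseE normrM ger0_norm ?invr_ge0 ?ler0n//.
rewrite ler_wpM2l ?invr_ge0 ?ler0n// (le_trans (ler_norm_sum _ _ _))//.
exact: ler_sum.
Qed.

Lemma iter_erase_sum l (I : finType) (P : pred I) (c : I -> R)
    (F : I -> {set 'I_n} -> R) A :
  iter l erase (fun B => \sum_(i | P i) c i * F i B) A =
  \sum_(i | P i) c i * iter l erase (F i) A.
Proof.
elim: l A => //= l IHl A; rewrite eraseE.
under [X in _ * X]eq_bigr do rewrite IHl.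
rewrite exchange_big mulr_sumr; apply: eq_bigr => i _.
by rewrite eraseE -mulr_sumr mulrCA.
Qed.

Lemma iter_eraseZ l (a : R) F A :
  iter l erase (fun B => a * F B) A = a * iter l erase F A.
Proof.
elim: l A => //= l IHl A; rewrite eraseE.
by under eq_bigr do rewrite IHl; rewrite -mulr_sumr eraseE mulrCA.
Qed.

(** Invariance under permutations of the coordinates: the k-subsets are
    permuted among themselves. *)
Lemma iter_erase_preim l (s : {perm 'I_n}) F A :
  iter l erase (fun B => F (s @^-1: B)) A = iter l erase F (s @^-1: A).
Proof.
elim: l A => //= l IHl A; rewrite !eraseE; congr (_ * _).
have preim_bij : bijective (fun S : {set 'I_n} => s @^-1: S).
  exists (fun S => (s^-1)%g @^-1: S) => S; apply/setP => i.
    by rewrite !inE permKV.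
  by rewrite !inE permK.
rewrite [RHS](reindex _ (onW_bij _ preim_bij)) /=.
apply: eq_big => [S|S _]; first by rewrite card_preimset//; exact: perm_inj.
by rewrite IHl finset.preimsetD.
Qed.

Hypotheses (n_gt0 : (0 < n)%N) (le_kn : (k <= n)%N).

Let bin_neq0 : 'C(n, k)%:R != 0 :> R.
Proof. by rewrite pnatr_eq0 -lt0n bin_gt0. Qed.

Lemma iter_eraseB_cst l F (a : R) A :
  iter l erase (fun B => F B - a) A = iter l erase F A - a.
Proof.
elim: l A => //= l IHl A; rewrite eraseE.
under eq_bigr do rewrite IHl.
rewrite eraseE sumrB mulrBr sumr_const; congr (_ - _).
have -> : #|[pred S : {set 'I_n} | #|S| == k]| = 'C(n, k).
  by rewrite -cardsE card_draws card_ord.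
by rewrite -[a *+ _]mulr_natl mulKf.
Qed.

Lemma card_avoiding (i : 'I_n) :
  #|[set S : {set 'I_n} | (#|S| == k) && (i \notin S)]| = 'C(n.-1, k).
Proof.
have -> : n.-1 = #|[set~ i]|.
  by rewrite cardsC1 card_ord.
rewrite -cards_draws; apply: eq_card => S.
by rewrite !inE andbC -finset.setCS finset.setCK finset.sub1set inE.
Qed.

(** A given coordinate escapes one step with probability
    C(n - 1, k) / C(n, k) = 1 - k / n; sizes add these probabilities up. *)
Lemma iter_erase_card l A :
  iter l erase (fun B => #|B|%:R) A = (1 - k%:R / n%:R) ^+ l * #|A|%:R :> R.
Proof.
elim: l A => [|l IHl] A; first by rewrite mul1r.
rewrite iterS /erase; under eq_bigr do rewrite IHl.
rewrite -mulr_sumr mulrCA exprSr -mulrA; congr (_ * _).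
rewrite -natr_sum.
have -> : (\sum_(S : {set 'I_n} | #|S| == k) #|A :\: S|)%N =
          (#|A| * 'C(n.-1, k))%N.
  under eq_bigr do rewrite -sum1_card big_mkcond.
  rewrite exchange_big /= -sum_nat_const [RHS]big_mkcond /=.
  apply: eq_bigr => i _; rewrite -(card_avoiding i) -sum1_card.
  case: ifPn => iA.
    rewrite [RHS](eq_bigl (fun S : {set _} => (#|S| == k) && (i \notin S)))
      => [|S]; last first.
      by rewrite inE.
    rewrite [RHS]big_mkcondr /=.
    by apply: eq_bigr => S _; rewrite inE iA andbT.
  by rewrite big1// => S _; rewrite inE (negPf iA) andbF.
have n_neq0 : n%:R != 0 :> R by rewrite pnatr_eq0 -lt0n.
have := congr1 (fun j => j%:R : R) (mul_bin_down n k).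
rewrite !natrM (natrB _ le_kn) => /(canRL (mulKf n_neq0)) ->.
by field; rewrite n_neq0.
Qed.

End Erasure.

(** * Averaging over permutations of the coordinates *)

Lemma card_notin (n : nat) (A : {set 'I_n}) :
  #|[pred j | j \notin A]| = (n - #|A|)%N.
Proof.
have cardAC : (#|A| + #|[predC A]| = n)%N by rewrite cardC card_ord.
exact: etrans (esym (addKn _ _)) (congr1 (subn^~ #|A|) cardAC).
Qed.

Section Symmetrization.
Set Implicit Arguments.
Unset Strict Implicit.
Variables (R : realType) (n : nat).
Implicit Types (F : {set 'I_n} -> R) (A : {set 'I_n}).

Definition symm F A : R :=
  \sum_(s : {perm 'I_n}) (n`!)%:R^-1 * F (s @^-1: A).

Lemma symm_cst (a : R) A : symm (fun=> a) A = a.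
Proof.
by rewrite /symm sumr_const card_Sn -[LHS]mulr_natl mulVKf.
Qed.

Lemma symmB F (G : {set 'I_n} -> R) A :
  symm (fun B => F B - G B) A = symm F A - symm G A.
Proof. by rewrite -sumrB; apply: eq_bigr => s _; rewrite mulrBr. Qed.

Lemma symm_norm_le F (d : R) A :
  (forall B : {set _}, #|B| = #|A| -> `|F B| <= d) -> `|symm F A| <= d.
Proof.
move=> leFd; rewrite -[leRHS](symm_cst d A) /symm.
rewrite (le_trans (ler_norm_sum _ _ _))//; apply: ler_sum => s _.
rewrite normrM ger0_norm ?invr_ge0 ?ler0n// ler_wpM2l ?invr_ge0 ?ler0n//.
by apply: leFd; rewrite card_preimset//; exact: perm_inj.
Qed.

(** In a uniformly random set of size #|A| + 1, the last element is uniform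
    among those outside the others: composing the permutation with the
    transposition of i and j does not change the average, for any j outside
    A, and one then averages over j. *)
Lemma symmU1 F A i : i \notin A ->
  symm F (i |: A) =
  symm (fun B => (n - #|B|)%:R^-1 * \sum_(j | j \notin B) F (j |: B)) A.
Proof.
move=> iA.
have swap j : j \notin A ->
    symm F (i |: A) =
    \sum_(s : {perm 'I_n}) n`!%:R^-1 * F ((s^-1)%g j |: s @^-1: A).
  move=> jA; rewrite /symm (reindex_inj (mulIg (tperm i j))) /=.
  apply: eq_bigr => s _; congr (_ * F _); apply/setP => h.
  rewrite !inE permM; congr (_ || _).
    by rewrite (canF_eq (tpermK i j)) tpermL (canF_eq (permK s)).
  case: tpermP => [->|->|//]; first by rewrite (negPf iA) (negPf jA).
  by rewrite (negPf iA) (negPf jA).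
have nA_neq0 : (n - #|A|)%:R != 0 :> R.
  by rewrite pnatr_eq0 -lt0n -card_notin; apply/card_gt0P; exists i.
apply: (mulfI nA_neq0).
rewrite mulr_natl -card_notin -sumr_const (eq_bigr _ swap) card_notin.
rewrite exchange_big mulr_sumr; apply: eq_bigr => s _.
rewrite card_preimset; last exact: perm_inj.
rewrite mulrCA mulVKf// -mulr_sumr; congr (_ * _).
rewrite (reindex_inj (@perm_inj _ s)); apply: eq_big => j.
  by rewrite inE.
by rewrite permK.
Qed.

End Symmetrization.

(** * The uniform law with pinned coordinates *)

(** The centering lets half of the sum over all y stand for the sum over B,
    whence the factor 1/2.  The bound E |D| <= v comes from the inequality
    |D| <= (D^2 / v + v) / 2. *)
Lemma norm_centered_sum_le (R : realType) (T : finType) (u D : T -> R)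
    (v : R) (B : {set T}) :
  0 < v -> (forall y, 0 <= u y) -> \sum_y u y = 1 ->
  \sum_y u y * D y = 0 -> \sum_y u y * D y ^+ 2 <= v ^+ 2 ->
  `|\sum_(y in B) u y * D y| <= v / 2.
Proof.
move=> v_gt0 u_ge0 u1 D0 leDv.
have abs_le : \sum_y u y * `|D y| <= v.
  have le_amgm y : u y * `|D y| <= (u y * D y ^+ 2 / v + u y * v) / 2.
    rewrite [leRHS](_ : _ = u y * ((D y ^+ 2 / v + v) / 2)); last by ring.
    rewrite ler_wpM2l// -[D y ^+ 2]real_normK ?num_real//.
    rewrite -subr_ge0 [X in 0 <= X](_ : _ = (`|D y| - v) ^+ 2 / v / 2).
      by rewrite !divr_ge0 ?sqr_ge0// ltW.
    by field; rewrite gt_eqF.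
  apply: le_trans (ler_sum _ (fun y _ => le_amgm y)) _.
  rewrite -mulr_suml big_split /= -!mulr_suml u1 mul1r.
  rewrite ler_pdivrMr// mulr_natr mulr2n lerD2r ler_pdivrMr//.
have abs_split : \sum_(y in B) u y * D y = - \sum_(y | y \notin B) u y * D y.
  apply/eqP; rewrite -addr_eq0; apply/eqP.
  by rewrite -[RHS]D0 [RHS](bigID (mem B)).
have le_abs (P : pred T) :
    `|\sum_(y | P y) u y * D y| <= \sum_(y | P y) u y * `|D y|.
  rewrite (le_trans (ler_norm_sum _ _ _))// ler_sum// => y _.
  by rewrite normrM ger0_norm.
rewrite ler_pdivlMr// mulr_natr mulr2n (le_trans _ abs_le)//.
rewrite [leRHS](bigID (mem B)) /= lerD ?le_abs//.
by rewrite abs_split normrN le_abs.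
Qed.

Section Pinned.
Set Implicit Arguments.
Unset Strict Implicit.
Variables (R : realType) (m n : nat) (x : Zvec m n).
Hypothesis m_gt0 : (0 < m)%N.
Implicit Types (A S : {set 'I_n}) (y z : Zvec m n).

(** The product form makes every sum over y a product of one-coordinate sums,
    and makes the factors for the coordinates in A and outside A probability
    masses on Z/mZ. *)
Definition pinned A y : R :=
  \prod_(i < n) (if i \in A then (y 0 i == x 0 i)%:R else m%:R^-1).

Let m_neq0 : m%:R != 0 :> R.
Proof. by rewrite pnatr_eq0 -lt0n. Qed.

Let card_Zmod : #|Zmod m| = m.
Proof. by rewrite card_ord prednK. Qed.

Lemma pinned_ge0 A y : 0 <= pinned A y.
Proof. by apply: prodr_ge0 => i _; case: ifP; rewrite ?invr_ge0 ler0n. Qed.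

Lemma pinned0 y : pinned finset.set0 y = uniform_mass R y.
Proof.
rewrite /pinned /uniform_mass card_mx mul1n card_Zmod natrX -exprVn.
under eq_bigr do rewrite inE.
by rewrite prodr_const card_ord.
Qed.

Lemma pinnedT y : pinned [set: 'I_n] y = (y == x)%:R.
Proof.
have [->|yx] := eqVneq y x; first by apply: big1 => i _; rewrite inE eqxx.
have [i yxi] : exists i, y 0 i != x 0 i.
  apply/existsP; apply: contra_neqT yx => /existsPn yx.
  by apply/rowP => i; apply/eqP; have := yx i; rewrite negbK.
by rewrite /pinned (bigD1 i) //= inE (negPf yxi) mul0r.
Qed.

(** The bijection f is the identity for the total mass of [pinned], and
    a |-> y_i - a when the uniform coefficients of one step are summed out. *)
Lemma sum_pinned_factor (b : bool) (c : Zmod m) (f : Zmod m -> Zmod m) :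
  bijective f ->
  \sum_(a : Zmod m) (if b then (f a == c)%:R else m%:R^-1) = 1 :> R.
Proof.
move=> f_bij; case: b; last first.
  by rewrite sumr_const card_Zmod -[LHS]mulr_natl divff.
have [g fK gK] := f_bij; rewrite (bigD1 (g c)) //= gK eqxx big1 ?addr0// => a.
by rewrite -(can2_eq fK gK) => /negPf ->.
Qed.

Lemma sum_pinned A : \sum_y pinned A y = 1.
Proof.
rewrite (reindex (fun f : {ffun 'I_n -> Zmod m} => \row_i f i)) /=; last first.
  exists (fun y => [ffun i => y 0 i]) => [f _|y _].
    by apply/ffunP => i; rewrite ffunE mxE.
  by apply/rowP => i; rewrite mxE ffunE.
pose F i (a : Zmod m) : R := if i \in A then (a == x 0 i)%:R else m%:R^-1.
rewrite (eq_bigr (fun f : {ffun _} => \prod_i F i (f i))) => [|f _]; last first.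
  by apply: eq_bigr => i _; rewrite mxE.
rewrite -bigA_distr_bigA.
apply: big1 => i _; apply: (@sum_pinned_factor _ _ id); exact: inv_bij.
Qed.

Lemma pinnedU1 A j y : j \notin A ->
  pinned (j |: A) y = m%:R * (y 0 j == x 0 j)%:R * pinned A y.
Proof.
move=> jA; rewrite /pinned (bigD1 j) //= [in RHS](bigD1 j) //=.
rewrite finset.setU11 (negPf jA) mulrACA mulfV// mul1r; congr (_ * _).
by apply: eq_bigr => i ij; rewrite !inE (negPf ij).
Qed.

(** The relative change of the density when coordinate j is pinned as well. *)
Let excess j y : R := m%:R * (y 0 j == x 0 j)%:R - 1.

Lemma pinned_excess A j y : j \notin A ->
  pinned A y * excess j y = pinned (j |: A) y - pinned A y.
Proof. by move=> jA; rewrite pinnedU1// /excess; ring. Qed.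

Lemma sum_pinned_excess A j : j \notin A -> \sum_y pinned A y * excess j y = 0.
Proof.
move=> jA; under eq_bigr do rewrite pinned_excess//.
by rewrite sumrB !sum_pinned subrr.
Qed.

(** Under [pinned A] distinct free coordinates are independent, so their
    excesses are uncorrelated; for i = j this is the variance. *)
Lemma pinned_excess_cov A i j : i \notin A -> j \notin A ->
  \sum_y pinned A y * (excess i y * excess j y) = (m%:R - 1) * (i == j)%:R.
Proof.
move=> iA jA; under eq_bigr do rewrite mulrA pinned_excess// mulrBl.
rewrite sumrB [X in _ - X]sum_pinned_excess// subr0.
have [<-|ij] := eqVneq i j; last first.
  by rewrite mulr0 sum_pinned_excess// !inE negb_or eq_sym ij.
rewrite [true%:R]mulr1n -[X in _ = _ * X](sum_pinned (i |: A)) mulr_sumr.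
apply: eq_bigr => y _; rewrite pinnedU1// /excess.
by case: eqP => _; rewrite ?mulr1n ?mulr0n; ring.
Qed.

(** The average excess over the n - #|A| free coordinates has mean 0 and
    variance (m - 1) / (n - #|A|). *)
Lemma avg_pinnedU1_dist A (v : R) (B : {set Zvec m n}) :
  (#|A| < n)%N -> 0 < v -> (m%:R - 1) / (n - #|A|)%:R <= v ^+ 2 ->
  `|(n - #|A|)%:R^-1 * (\sum_(j | j \notin A) meas (pinned (j |: A)) B)
    - meas (pinned A) B| <= v / 2.
Proof.
move=> ltAn v_gt0 lev; set r : R := (n - #|A|)%:R.
have r_neq0 : r != 0 by rewrite pnatr_eq0 -lt0n subn_gt0.
have cardC : \sum_(j | j \notin A) 1 = r.
  by rewrite sumr_const card_notin.
pose D y := r^-1 * \sum_(j | j \notin A) excess j y.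
have -> : r^-1 * (\sum_(j | j \notin A) meas (pinned (j |: A)) B)
    - meas (pinned A) B = \sum_(y in B) pinned A y * D y.
  rewrite exchange_big mulr_sumr -sumrB; apply: eq_bigr => y _.
  rewrite /D mulrCA [X in _ = _ * X]mulr_sumr.
  under [in RHS]eq_bigr do rewrite pinned_excess//.
  rewrite sumrB mulrBr; congr (_ - _).
  rewrite -[pinned A y]mul1r -mulr_suml cardC.
  by rewrite !mul1r mulKf.
apply: norm_centered_sum_le => //.
- exact: pinned_ge0.
- exact: sum_pinned.
- under eq_bigr do rewrite /D mulrCA mulr_sumr.
  rewrite -mulr_sumr exchange_big big1 ?mulr0// => j jA.
  exact: sum_pinned_excess.
- rewrite [leLHS](_ : _ = (m%:R - 1) / r)//.
  have D2 y : D y ^+ 2 = r^-1 ^+ 2 *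
      \sum_(i | i \notin A) \sum_(j | j \notin A) excess i y * excess j y.
    by rewrite /D exprMn [X in _ * X]expr2 big_distrlr.
  under eq_bigr do rewrite D2 mulrCA mulr_sumr.
  rewrite -mulr_sumr exchange_big /=.
  rewrite (eq_bigr (fun=> (m%:R - 1) * 1)) => [|i iA].
    by rewrite -mulr_sumr cardC; field.
  under eq_bigr do rewrite mulr_sumr.
  rewrite exchange_big /= (eq_bigr (fun j => (m%:R - 1) * (i == j)%:R)).
    rewrite (bigD1 i) //= eqxx big1 ?addr0// => j /andP[_ ji].
    by rewrite eq_sym (negPf ji) mulr0.
  by move=> j jA; rewrite pinned_excess_cov.
Qed.

End Pinned.

(** * Linear bound for a random pinned set of given size *)

(** Induction on #|A|, adding one coordinate at a time while m (#|A| - 1) <= n;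
    beyond that point the right-hand side is at least 1. *)
Lemma symm_pinned_dist (R : realType) (m n : nat) (x : Zvec m n)
    (B : {set Zvec m n}) (A : {set 'I_n}) :
  (0 < m)%N -> (0 < n)%N ->
  `|symm (fun C => meas (pinned R x C) B) A - meas (@uniform_mass R _) B|
  <= Num.sqrt (m%:R / n%:R) / 2 * #|A|%:R.
Proof.
move=> m_gt0 n_gt0; set v := Num.sqrt _.
have n_gt0' : 0 < n%:R :> R by rewrite ltr0n.
have m_gt0' : 0 < m%:R :> R by rewrite ltr0n.
have v_gt0 : 0 < v by rewrite sqrtr_gt0 divr_gt0.
have v2 : v ^+ 2 = m%:R / n%:R by rewrite sqr_sqrtr// ltW// divr_gt0.
pose F (C : {set 'I_n}) := meas (pinned R x C) B.
have F0 : meas (@uniform_mass R _) B = F finset.set0.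
  by apply: eq_bigr => y _; rewrite pinned0.
have F_ge0 C : 0 <= F C by apply: sumr_ge0 => y _; exact: pinned_ge0.
have F_le1 C : F C <= 1.
  rewrite -(sum_pinned R x m_gt0 C) [leRHS](bigID (mem B)) /= lerDl.
  by apply: sumr_ge0 => y _; exact: pinned_ge0.
rewrite F0; move: {2}#|A| (erefl #|A|) => a; elim: a A => [|a IHa] A cardA.
  rewrite (cards0_eq cardA) cards0 mulr0.
  rewrite (_ : symm _ _ = F finset.set0) ?subrr ?normr0//.
  rewrite -[RHS](symm_cst (F finset.set0) A).
  by apply: eq_bigr => s _; rewrite finset.preimset0.
have [le_man|lt_nma] := leqP (m * a) n.
  (* (m - 1) / (n - a) <= m / n is equivalent to m a <= n. *)
  have /card_gt0P[i iA] : (0 < #|A|)%N by rewrite cardA.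
  have cardA' : #|A :\ i| = a.
    by apply/eq_add_S; rewrite -cardA (cardsD1 i A) iA.
  have lt_an : (a < n)%N by rewrite -cardA -[leqRHS]card_ord max_card.
  rewrite -(finset.setD1K iA) symmU1 ?setD11//.
  rewrite -(subrKA (symm F (A :\ i))) (le_trans (ler_normD _ _))//.
  rewrite finset.setD1K// cardA -[a.+1%:R]natr1 mulrDr mulr1 addrC lerD//.
    by have := IHa _ cardA'; rewrite cardA'.
  rewrite -symmB symm_norm_le// cardA' => C cardC.
  rewrite avg_pinnedU1_dist ?cardC// v2 (natrB _ (ltnW lt_an)).
  rewrite ler_pdivrMr ?subr_gt0 ?ltr_nat// mulrAC ler_pdivlMr//.
  rewrite -subr_ge0 [X in 0 <= X](_ : _ = n%:R - (m * a)%:R).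
    by rewrite subr_ge0 ler_nat.
  by rewrite natrM; ring.
(* Here (a + 1)^2 m >= 4 a m > 4 n, so the right-hand side is at least 1. *)
rewrite -[X in _ - X](symm_cst (F finset.set0) A) -symmB.
apply: (@le_trans _ _ 1).
  apply: symm_norm_le => C _; rewrite ler_norml -/(F C).
  move: (F_ge0 C) (F_le1 C) (F_ge0 finset.set0) (F_le1 finset.set0).
  by move=> *; apply/andP; split; lra.
rewrite cardA mulrAC ler_pdivlMr// mul1r.
rewrite -ler_sqr ?nnegrE ?mulr_ge0 ?ler0n ?(ltW v_gt0)//.
rewrite exprMn v2 mulrAC ler_pdivlMr//.
apply: (@le_trans _ _ (4 * (m%:R * a%:R))).
  have : n%:R <= m%:R * a%:R :> R by rewrite -natrM ler_nat ltnW.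
  by move=> ?; lra.
rewrite mulrCA ler_pM2l// -natr1 -subr_ge0.
rewrite [X in 0 <= X](_ : _ = (a%:R - 1) ^+ 2) ?sqr_ge0//; ring.
Qed.

(** * The law of the walk as a mixture of pinned laws *)

Section WalkLaw.
Set Implicit Arguments.
Unset Strict Implicit.
Variables (R : realType) (m n : nat).
Hypothesis m_gt0 : (0 < m)%N.

Lemma comb_vec_in (S : {set 'I_n}) (a : {ffun {i | i \in S} -> Zmod m}) i :
  comb_vec a 0 (val i) = a i.
Proof.
rewrite summxE (bigD1 i) //= big1 => [|j ji].
  rewrite addr0 mulmxnE mxE eqxx Zp_mulrn /= -[RHS]valZpK.
  by apply: val_inj => /=; rewrite modnMml mul1n.
by rewrite mulmxnE mxE (inj_eq val_inj) eq_sym (negPf ji) mul0rn.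
Qed.

Lemma comb_vec_notin (S : {set 'I_n}) (a : {ffun {i | i \in S} -> Zmod m}) i :
  i \notin S -> comb_vec a 0 i = 0.
Proof.
move=> iS; rewrite summxE big1// => j _.
rewrite mulmxnE mxE; case: eqP => [ij|]; last by rewrite mul0rn.
by rewrite ij (valP j) in iS.
Qed.

(** A step that uses the coordinates in S makes them uniform and leaves the
    others alone, so it releases the pins in S. *)
Lemma sum_pinned_comb_vec x (A S : {set 'I_n}) (y : Zvec m n) :
  \sum_(a : {ffun {i | i \in S} -> Zmod m})
     (m%:R ^+ #|S|)^-1 * pinned R x A (y - comb_vec a) =
  pinned R x (A :\: S) y.
Proof.
pose f i (c : Zmod m) : R :=
  if i \in A then (y 0 i - c == x 0 i)%:R else m%:R^-1.
have pinnedE (a : {ffun {i | i \in S} -> Zmod m}) :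
    pinned R x A (y - comb_vec a) =
    (\prod_(i | i \notin S) f i 0) * \prod_i f (val i) (a i).
  rewrite /pinned (bigID (mem S)) /= mulrC; congr (_ * _).
    by apply: eq_bigr => i iS; rewrite !mxE comb_vec_notin.
  rewrite big_sub; apply: eq_bigr => i _.
  by rewrite !mxE comb_vec_in.
under eq_bigr do rewrite pinnedE mulrA.
rewrite -mulr_sumr -(bigA_distr_bigA (fun i : {i | i \in S} => f (val i))) /=.
rewrite [X in _ * X]big1 => [|i _]; last first.
  rewrite /f.
  apply: (@sum_pinned_factor R m m_gt0 _ _ (fun c => y 0 (val i) - c)).
  by apply: inv_bij => c; rewrite opprB addrC subrK.
rewrite mulr1 /pinned [RHS](bigID (mem S)) /=; congr (_ * _).
  rewrite -exprVn -prodr_const; apply: eq_bigr => i iS.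
  by rewrite inE iS.
by apply: eq_bigr => i iS; rewrite /f inE iS subr0.
Qed.

Variable k : nat.

Lemma sum_pinned_trans x A (y : Zvec m n) :
  \sum_z pinned R x A z * trans (@ksubset_mass R m n k) z y =
  erase k (fun B => pinned R x B y) A.
Proof.
rewrite eraseE /trans /ksubset_mass.
under eq_bigr do rewrite mulr_sumr.
rewrite exchange_big mulr_sumr; apply: eq_bigr => S /eqP cardS.
rewrite -sum_pinned_comb_vec mulr_sumr.
under eq_bigr do rewrite mulr_sumr big_mkcond.
rewrite exchange_big; apply: eq_bigr => a _.
rewrite (bigD1 (y - comb_vec a)) //= subKr eqxx big1 => [|z].
  by rewrite addr0 cardS invfM mulrC mulrA.
by move=> /negP zy; case: eqP => // az; case: zy; rewrite az subKr.
Qed.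

Lemma walk_lawE x l (y : Zvec m n) :
  walk_law (@ksubset_mass R m n k) x l y =
  iter l (erase k) (fun A => pinned R x A y) [set: 'I_n].
Proof.
elim: l y => [|l IHl] y /=; first by rewrite pinnedT.
rewrite -iterS iter_eraseS.
rewrite -(eq_iter_erase _ _ (fun A => sum_pinned_trans x A y)).
rewrite (eq_iter_erase _ _ (G := fun A =>
  \sum_z trans (ksubset_mass R k) z y * pinned R x A z)); last first.
  by move=> A; apply: eq_bigr => z _; rewrite mulrC.
rewrite iter_erase_sum; apply: eq_bigr => z _.
by rewrite IHl mulrC.
Qed.

(** By invariance the event probabilities may be symmetrized before the linear
    bound is averaged; the mean size n (1 - k/n)^l then comes out. *)
Lemma meas_walk_dist x l (B : {set Zvec m n}) :
  (0 < n)%N -> (k <= n)%N ->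
  `|meas (walk_law (@ksubset_mass R m n k) x l) B -
    meas (@uniform_mass R _) B| <=
  Num.sqrt (m%:R / n%:R) / 2 * (n%:R * (1 - k%:R / n%:R) ^+ l).
Proof.
move=> n_gt0 le_kn; pose F A := meas (pinned R x A) B.
have -> : meas (walk_law (@ksubset_mass R m n k) x l) B =
          iter l (erase k) F [set: 'I_n].
  rewrite (eq_iter_erase _ _ (G := fun A => \sum_(y in B) 1 * pinned R x A y)).
    rewrite iter_erase_sum; apply: eq_bigr => y _.
    by rewrite mul1r walk_lawE.
  by move=> A; apply: eq_bigr => y _; rewrite mul1r.
have -> : iter l (erase k) F [set: 'I_n] =
          iter l (erase k) (symm F) [set: 'I_n].
  rewrite iter_erase_sum -[LHS](symm_cst _ [set: 'I_n]); apply: eq_bigr => s _.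
  by rewrite iter_erase_preim finset.preimsetT.
rewrite -iter_eraseB_cst//.
have le_symm A : `|symm F A - meas (@uniform_mass R _) B| <=
    Num.sqrt (m%:R / n%:R) / 2 * #|A|%:R by exact: symm_pinned_dist.
apply: le_trans (iter_erase_norm_le k l [set: 'I_n] le_symm) _.
by rewrite iter_eraseZ iter_erase_card// cardsT card_ord [_ * n%:R]mulrC.
Qed.

End WalkLaw.

(** * From the mean number of unchosen coordinates to the rate *)

Theorem theorem1p2 (R : realType) (m n k : nat)
    (hm : (0 < m)%N) (hn : (0 < n)%N) (hk : (0 < k)%N) (hkn : (k <= n)%N)
    (c : R) (l : nat)
    (hl : l%:R = n.+1%:R / (2 * k%:R) * ln ((m * n)%N%:R)
                 + c * n.+1%:R / (2 * k%:R))
    (x : Zvec m n) :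
  4 * tv_dist (walk_law (@ksubset_mass R m n k) x l)
              (@uniform_mass R (Zvec m n)) ^+ 2 <= expR (- c).
Proof.
set d := tv_dist _ _.
have n_gt0 : 0 < n%:R :> R by rewrite ltr0n.
have m_gt0 : 0 < m%:R :> R by rewrite ltr0n.
have k_gt0 : 0 < k%:R :> R by rewrite ltr0n.
set p : R := (1 - k%:R / n%:R) ^+ l.
have ub : ubound (range (fun B : {set Zvec m n} =>
    `|meas (walk_law (@ksubset_mass R m n k) x l) B -
      meas (@uniform_mass R _) B|))
    (Num.sqrt (m%:R / n%:R) / 2 * (n%:R * p)).
  by move=> _ [B _ <-]; exact: meas_walk_dist.
have d_le : d <= Num.sqrt (m%:R / n%:R) / 2 * (n%:R * p).
  by apply: ge_sup => //; eexists; exists finset.set0.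
have d_ge0 : 0 <= d.
  apply: le_trans (normr_ge0 _) _.
  by apply: (ub_le_sup (ex_intro _ _ ub)); exists finset.set0.
have d2_le : 4 * d ^+ 2 <= m%:R * n%:R * p ^+ 2.
  apply: (@le_trans _ _ (4 * (Num.sqrt (m%:R / n%:R) / 2 * (n%:R * p)) ^+ 2)).
    by rewrite ler_pM2l// ler_sqr ?nnegrE ?(le_trans d_ge0).
  rewrite !exprMn sqr_sqrtr ?divr_ge0 ?ler0n//.
  rewrite le_eqVlt; apply/orP; left; apply/eqP; field; exact: lt0r_neq0.
apply: le_trans d2_le _.
have kn_ge0 : 0 <= 1 - k%:R / n%:R :> R.
  by rewrite subr_ge0 ler_pdivrMr// mul1r ler_nat.
have p_le : p ^+ 2 <= expR (- (2 * (l%:R * (k%:R / n%:R)))).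
  rewrite (_ : - _ = - (k%:R / n%:R) * (l * 2)%:R).
    rewrite expRM_natr /p -exprM lerXn2r ?nnegrE ?expR_ge0//.
    exact: expR_ge1Dx.
  by rewrite natrM; ring.
have mn_gt0 : 0 < (m * n)%:R :> R by rewrite ltr0n muln_gt0 hm.
apply: (@le_trans _ _ (m%:R * n%:R * expR (- (2 * (l%:R * (k%:R / n%:R)))))).
  by rewrite ler_pM2l// mulr_gt0.
have -> : - c = ln (m * n)%:R - 2 * (l%:R * (k%:R / n.+1%:R)).
  rewrite hl; field; rewrite (lt0r_neq0 k_gt0) /=.
  by rewrite addrC natr1 pnatr_eq0.
rewrite expRD lnK ?posrE// natrM ler_pM2l ?mulr_gt0// ler_expR lerN2.
rewrite !ler_wpM2l// ?ler0n// lef_pV2 ?posrE ?ltr0n//.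
by rewrite ler_nat.
Qed.
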